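(* Let $r\geq 2$ and let $\mathfrak{b}$ be a Borel subalgebra of the complex symplectic Lie algebra $\mathfrak{sp}_{2r}$ (simple of type $C_r$). For every integer $m\ge 0$, the number of abelian ideals of $\mathfrak{b}$ of dimension $m$ is equal to the coefficient of $t^m$ in the polynomial $$f_{C_r}(t)=(1+t)(1+t^2)\cdots(1+t^r).$$
   Context: An abelian ideal of $\mathfrak{b}$ is an ideal $I$ of the Lie algebra $\mathfrak{b}$ with $[I,I]=0$ (the zero ideal is included); dimension is over $\mathbb{C}$. *)

(* Defs.v *)
From HB Require Import structures.
From mathcomp Require Import all_boot all_order all_algebra.
From mathcomp Require Import all_classical all_reals.
From mathcomp Require Import complex.

Set Implicit Arguments.
Unset Strict Implicit.
Unset Printing Implicit Defensive.

Import GRing.Theory.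
Local Open Scope ring_scope.

Section LieMatrix.
Variables (F : fieldType) (n : nat).
Implicit Types (A B : 'M[F]_n) (U V W g b I : {vspace 'M[F]_n}).

Definition lie_bracket A B : 'M[F]_n := A *m B - B *m A.

(* [U, V]: brackets of basis vectors suffice to span it, by bilinearity; see
   lie_prodP. *)
Definition lie_prod U V : {vspace 'M[F]_n} :=
  <<[seq lie_bracket A B | A <- vbasis U, B <- vbasis V]>>%VS.

Definition lie_subalgebra g U : Prop :=
  (U <= g)%VS /\ (lie_prod U U <= U)%VS.

Definition lie_derived_series k U : {vspace 'M[F]_n} :=
  iter k (fun W => lie_prod W W) U.

Definition lie_solvable U : Prop :=
  exists k, lie_derived_series k U = 0%VS.

Definition borel_subalgebra g b : Prop :=
  [/\ lie_subalgebra g b, lie_solvable b &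
      forall U, lie_subalgebra g U -> lie_solvable U -> (b <= U)%VS -> U = b].

Definition lie_ideal b I : Prop := (I <= b)%VS /\ (lie_prod b I <= I)%VS.

Definition lie_abelian I : Prop := lie_prod I I = 0%VS.

Definition abelian_ideal b I : Prop := lie_ideal b I /\ lie_abelian I.

Lemma lie_prodP U V W :
  reflect {in U & V, forall A B, lie_bracket A B \in W} (lie_prod U V <= W)%VS.
Proof.
apply: (iffP span_subvP) => [sUVW A B UA VB | sUVW _ /allpairsP[[A B] /= [UA VB ->]]].
  rewrite /lie_bracket (coord_vbasis UA) (coord_vbasis VB).
  rewrite mulmx_suml mulmx_sumr -sumrB memv_suml // => i _.
  rewrite -scalemxAl -scalemxAr -scalerBr memvZ //.
  rewrite mulmx_sumr mulmx_suml -sumrB memv_suml // => j _.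
  rewrite -scalemxAl -scalemxAr -scalerBr memvZ //.
  by apply: sUVW; apply: allpairs_f; apply: mem_nth; rewrite size_tuple.
by apply: sUVW; apply: vbasis_mem.
Qed.

End LieMatrix.

Section Symplectic.
Variables (F : fieldType) (r : nat).

Definition symplectic_form : 'M[F]_(r + r) := block_mx 0 1%:M (- 1%:M) 0.

Definition sp_map (A : 'M[F]_(r + r)) : 'M[F]_(r + r) :=
  A^T *m symplectic_form + symplectic_form *m A.

Lemma sp_map_linear : linear sp_map.
Proof.
move=> a A B; rewrite /sp_map linearP /= mulmxDl mulmxDr -scalemxAl -scalemxAr.
by rewrite scalerDr addrACA.
Qed.

HB.instance Definition _ :=
  GRing.isLinear.Build F 'M[F]_(r + r) 'M[F]_(r + r) *:%R sp_map sp_map_linear.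

(* sp_(2r) = {A | A^T J + J A = 0}; see mem_sp. *)
Definition sp : {vspace 'M[F]_(r + r)} := lker (linfun sp_map).

Lemma mem_sp A :
  (A \in sp) = (A^T *m symplectic_form + symplectic_form *m A == 0).
Proof. by rewrite memv_ker lfunE. Qed.

End Symplectic.

Arguments sp F r : clear implicits.

Definition f_C (r : nat) : {poly nat} := \prod_(1 <= i < r.+1) (1 + 'X^i).

(* Main.v *)
From HB Require Import structures.
Require Import Defs.
From mathcomp Require Import all_boot all_order all_algebra.
From mathcomp Require Import all_classical all_reals.
From mathcomp Require Import complex.
From mathcomp Require Import ring.

Set Implicit Arguments.
Unset Strict Implicit.
Unset Printing Implicit Defensive.

Import GRing.Theory.
Local Open Scope ring_scope.

(** The proof replaces an arbitrary Borel subalgebra by an explicit one, shows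
    that its abelian ideals consist of symmetric matrices, and recognizes the
    possible ideals as the shifted Young diagrams of strict partitions.

    Conjugacy. Matrices act on row vectors on the right. By Lie's theorem
    ([lie_common_eigenvector]) a solvable algebra acting on a nonzero space has
    a common eigenvector; applied to the quotient of the orthogonal of an
    isotropic subspace by that subspace, it lets one grow a stable complete
    isotropic flag ([stable_isotropic_flag]). A basis of the flag extends to a
    symplectic basis ([lagrangian_extend]), in which the algebra lies in
    [std_borel], the algebra of all block matrices (T, 0; S, -T^T) with T lower
    triangular and S symmetric. Since [std_borel] is solvable, a maximal
    solvable subalgebra is conjugate to it ([borel_conjugate]).

    Abelian ideals of [std_borel]. Let A = (T, 0; S, -T^T) be in an abelian ideal.
    Its bracket with (0, 0; E_ii, 0) is again in the ideal, hence commutes with A,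
    and the coefficients of this relation for all i force T = 0
    ([abelian_ideal_lower]). So the ideal is a space of symmetric matrices stable
    under S |-> T^T S + S T for all lower triangular T. Stability under diagonal T
    makes it a span of the matrices E_ij + E_ji, by a projection on the weight
    spaces ([ideal_sym_unit]), and stability under the E_ij with j < i says
    that the set of the pairs (i, j) that occur is closed under lowering an
    index ([ideal_sym_unit_lower]).

    Counting. A symmetric set of pairs of indices below r that is closed under
    lowering an index is a self-conjugate Young diagram in an r x r square.
    Keeping the cells on or above the diagonal, its rows have strictly
    decreasing lengths at most r, and any such sequence of lengths occurs
    ([shape_exists], [shape_inj]). The dimension of the ideal is the number of
    those cells ([dim_shape_ideal]), so that the ideals of dimension m
    correspond to the sets of distinct integers of 1, ..., r with sum m, which
    the product of the 1 + t^i enumerates ([coef_f_C]). *)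

(** * Weights along a Krylov flag *)

Section Krylov.
Variables (F : fieldType) (n : nat).
Implicit Types (x A : 'M[F]_n) (w : 'rV[F]_n).

Definition krylov_vec x w i : 'rV[F]_n := iter i (mulmx^~ x) w.

Definition krylov x w i : 'M[F]_n := (\sum_(j < i) <<krylov_vec x w j>>)%MS.

Lemma krylov_vec_sub x w i j : (i < j)%N -> (krylov_vec x w i <= krylov x w j)%MS.
Proof. by move=> lt_ij; apply: (sumsmx_sup (Ordinal lt_ij)); rewrite ?genmxE. Qed.

Lemma krylov_mono x w i j : (i <= j)%N -> (krylov x w i <= krylov x w j)%MS.
Proof.
move=> le_ij; apply/sumsmx_subP => k _; rewrite genmxE krylov_vec_sub //.
exact: leq_trans (ltn_ord k) le_ij.
Qed.

Lemma krylov_mul x w i : (krylov x w i *m x <= krylov x w i.+1)%MS.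
Proof.
rewrite sumsmxMr; apply/sumsmx_subP => k _.
rewrite (eqmxMr _ (genmxE _)).
by apply: (krylov_vec_sub x w (_ : k.+1 < i.+1)%N); rewrite ltnS.
Qed.

Lemma krylov_dependent x w : exists i, (krylov_vec x w i <= krylov x w i)%MS.
Proof.
apply/not_existsP => free_w.
have rank_ge i : (i <= \rank (krylov x w i))%N.
  elim: i => // i /leq_ltn_trans-> //; apply: rank_ltmx.
  rewrite ltmxE krylov_mono //=; apply/negP => /(submx_trans _) sub.
  by apply: (free_w i); apply: sub; apply: krylov_vec_sub.
by have := leq_trans (rank_ge n.+1) (rank_leq_row _); rewrite ltnn.
Qed.

(** Commuting A past one factor x at a time costs one bracket [x, A] each, whose
    leading effect on [krylov_vec x w i] is its own weight. Keeping the second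
    leading term, and not just the triangularity of A on the flag, is what
    makes the trace of [x, A] unnecessary in [weight_bracket0]. *)
Lemma krylov_action (S : 'M[F]_n -> Prop) (lam : 'M[F]_n -> F) x w :
    (forall A, S A -> S (lie_bracket x A)) ->
    (forall A, S A -> w *m A = lam A *: w) ->
  forall A i, S A ->
    (krylov_vec x w i.+1 *m A - lam A *: krylov_vec x w i.+1
       - (lam (lie_bracket x A) *+ i.+1) *: krylov_vec x w i <= krylov x w i)%MS.
Proof.
move=> Sx Sw A i; elim: i A => [|i IHi] A SA.
  rewrite /krylov_vec /= -mulmxA.
  rewrite (_ : x *m A = A *m x + lie_bracket x A); last by rewrite addrC subrK.
  rewrite mulmxDr mulmxA (Sw _ SA) (Sw _ (Sx _ SA)) -scalemxAl.
  by rewrite [_ + lam _ *: w]addrC addrK mulr1n subrr sub0mx.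
set e := krylov_vec x w in IHi *.
have -> : e i.+2 = e i.+1 *m x by [].
rewrite -mulmxA (_ : x *m A = A *m x + lie_bracket x A); last by rewrite addrC subrK.
set B := lie_bracket x A.
have SB : S B by exact: Sx.
rewrite mulmxDr mulmxA [lam B *+ _]mulrS scalerDl.
have [u u_sub ->] : exists2 u, (u <= krylov x w i)%MS &
    e i.+1 *m A = lam A *: e i.+1 + (lam B *+ i.+1) *: e i + u.
  exists (e i.+1 *m A - lam A *: e i.+1 - (lam B *+ i.+1) *: e i); first exact: IHi.
  by rewrite -[_ - _ - _]addrA -opprD [RHS]addrC subrK.
have [v v_sub ->] : exists2 v, (v <= krylov x w i.+1)%MS &
    e i.+1 *m B = lam B *: e i.+1 + v.
  exists (e i.+1 *m B - lam B *: e i.+1); last by rewrite [RHS]addrC subrK.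
  rewrite -[_ - _](subrK ((lam (lie_bracket x B) *+ i.+1) *: e i)) addmx_sub //.
    exact: submx_trans (IHi B SB) (krylov_mono _ _ (leqnSn i)).
  by rewrite scalemx_sub // krylov_vec_sub.
rewrite !mulmxDl -!scalemxAl -[e i *m x]/(e i.+1).
set a := lam A *: _; set b := (lam B *+ _) *: _; set c := lam B *: _.
have -> : a + b + u *m x + (c + v) - a - (c + b) = u *m x + v.
  move: a b c (u *m x) (v) => a b c y z.
  by apply/rowP => k; rewrite !mxE; ring.
by rewrite addmx_sub // (submx_trans (submxMr x u_sub)) ?krylov_mul.
Qed.

(** The invariance lemma behind Lie's theorem. Take d + 1 to be the first index
    where the Krylov flag stops growing: A acts as the scalar lam A modulo the
    d-th step on all earlier vectors, hence also on their combination
    [krylov_vec x w d.+1], so the second term in [krylov_action] must vanish;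
    it is (d + 1) lam [x, A] times a vector outside that step. *)
Lemma weight_bracket0 (S : 'M[F]_n -> Prop) (lam : 'M[F]_n -> F) x w :
    [pchar F] =i pred0 -> w != 0 ->
    (forall A, S A -> S (lie_bracket x A)) ->
    (forall A, S A -> w *m A = lam A *: w) ->
  forall A, S A -> lam (lie_bracket x A) = 0.
Proof.
move=> /pcharf0P F0 w0 Sx Sw A SA.
have [d] := ex_minnP (krylov_dependent x w).
case: d => [|d] sub_d min_d.
  by case/negP: w0; rewrite -submx0 (submx_trans sub_d) // /krylov big_ord0.
set K := krylov x w d.
have act i : (i <= d)%N ->
    (krylov_vec x w i *m A - lam A *: krylov_vec x w i <= K)%MS.
  case: i => [|i] le_id; first by rewrite (Sw _ SA) subrr sub0mx.
  set e := _ - _; set c := lam (lie_bracket x A) *+ i.+1.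
  rewrite -[e](subrK (c *: krylov_vec x w i)).
  rewrite addmx_sub ?scalemx_sub ?krylov_vec_sub //.
  exact: submx_trans (krylov_action Sx Sw _ SA) (krylov_mono _ _ (ltnW le_id)).
have top : (krylov_vec x w d.+1 *m A - lam A *: krylov_vec x w d.+1 <= K)%MS.
  rewrite -mul_mx_scalar -mulmxBr; apply: (submx_trans (submxMr _ sub_d)).
  rewrite sumsmxMr; apply/sumsmx_subP => j _.
  by rewrite (eqmxMr _ (genmxE _)) mulmxBr mul_mx_scalar act // -ltnS.
have : ((lam (lie_bracket x A) *+ d.+1) *: krylov_vec x w d <= K)%MS.
  have := krylov_action Sx Sw d SA; move: (_ - lam A *: _) top => T top.
  move: (_ *: _) => Z TZ.
  by rewrite -[Z](subKr T) addmx_sub ?eqmx_opp.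
apply: contraTeq => lam0.
rewrite eqmx_scale; last first.
  by rewrite -mulr_natr mulf_neq0 // F0.
by apply/negP => /min_d; rewrite ltnn.
Qed.

End Krylov.

(** * Lie's theorem *)

Section LieProducts.
Variables (F : fieldType) (n : nat).
Implicit Types (A B : 'M[F]_n) (U V L : {vspace 'M[F]_n}).

Lemma mem_lie_prod U V A B : A \in U -> B \in V -> lie_bracket A B \in lie_prod U V.
Proof. by move=> UA VB; have /lie_prodP := subvv (lie_prod U V); apply. Qed.

Lemma lie_prodS U U' V V' :
  (U <= U')%VS -> (V <= V')%VS -> (lie_prod U V <= lie_prod U' V')%VS.
Proof.
move=> /subvP sU /subvP sV; apply/lie_prodP => A B /sU UA /sV VB.
exact: mem_lie_prod.
Qed.

Lemma lie_derived_seriesS k U V :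
  (U <= V)%VS -> (lie_derived_series k U <= lie_derived_series k V)%VS.
Proof. by move=> sUV; elim: k => //= k IHk; apply: lie_prodS. Qed.

Lemma lie_solvableS U V : (U <= V)%VS -> lie_solvable V -> lie_solvable U.
Proof.
move=> sUV [k k0]; exists k; apply/eqP; rewrite -subv0 -k0.
exact: lie_derived_seriesS.
Qed.

(** Otherwise the derived series of L would be constant. *)
Lemma lie_solvable_proper L :
  lie_solvable L -> L != 0%VS -> ~~ (L <= lie_prod L L)%VS.
Proof.
move=> [k k0]; apply: contraNN => sL; rewrite -subv0 -k0.
by elim: k {k0} => //= k IHk; apply: subv_trans sL (lie_prodS _ _).
Qed.

(** Used with U = [L, L]: any subspace between [L, L] and L is an ideal of L. *)
Lemma hyperplane_above U L : (U <= L)%VS -> ~~ (L <= U)%VS ->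
  exists K, exists X, [/\ (U <= K)%VS, X \in L,
    L = (<[X]> + K)%VS & (\dim K < \dim L)%N].
Proof.
move=> sUL; rewrite -diffv_eq0 => D0.
have [s dimD spanD] : exists2 s, size s = \dim (L :\: U) & <<s>>%VS = (L :\: U)%VS.
  by exists (vbasis (L :\: U)); rewrite ?size_tuple ?(span_basis (vbasisP _)).
case: s dimD spanD => [|X s] /= dimD.
  by move/esym/eqP; rewrite span_nil (negPf D0).
rewrite span_cons => spanD; exists (<<s>> + U)%VS, X; split.
- exact: addvSr.
- by apply: subvP (diffvSl L U) _ _; rewrite -spanD memvE addvSl.
- by rewrite addvA spanD addv_diff; apply/esym/addv_idPl.
- rewrite -(dimv_cap_compl L U) (capv_idPr sUL) -dimD addnS ltnS addnC.
  by apply: leq_trans (dimv_add_leqif _ _) _; rewrite leq_add2r dim_span.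
Qed.

End LieProducts.

(** Lie's theorem, by induction on the dimension of L. A representation rho is
    allowed, rather than only the tautological one, so that the statement
    applies to the action on a quotient. A hyperplane K above [L, L] has a common
    eigenvector by induction; the space W of all vectors with the same
    weight on K is stable under a generator X of L modulo K, by
    [weight_bracket0], and any eigenvector of X in W will do. *)
Theorem lie_common_eigenvector (F : numClosedFieldType) n k
    (rho : {linear 'M[F]_n -> 'M[F]_k}) (L : {vspace 'M[F]_n}) :
    (0 < k)%N -> lie_solvable L -> (lie_prod L L <= L)%VS ->
    {in L &, {morph rho : A B / lie_bracket A B}} ->
  exists2 v : 'rV_k, v != 0 & forall A, A \in L -> stablemx v (rho A).
Proof.
move=> k_gt0; have [d] := ubnP (\dim L); elim: d L => // d IHd L ltLd solL subL rhoL.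
have [L0|L0] := eqVneq L 0%VS.
  exists (const_mx 1) => [|A].
    by apply/eqP => /rowP/(_ (Ordinal k_gt0))/eqP; rewrite !mxE oner_eq0.
  by rewrite L0 memv0 => /eqP->; rewrite linear0 mulmx0 sub0mx.
have [K [X [sLK XL defL ltKL]]] := hyperplane_above subL (lie_solvable_proper solL L0).
have sKL : (K <= L)%VS by rewrite defL addvSr.
have LX A : A \in K -> lie_bracket X A \in K.
  by move=> KA; apply: (subvP sLK); apply: mem_lie_prod => //; apply: (subvP sKL).
have [||||v v0 Kv] := IHd K.
- by apply: leq_trans ltKL _; rewrite -ltnS.
- exact: lie_solvableS solL.
- by apply: subv_trans sLK; apply: lie_prodS.
- by move=> A B /(subvP sKL) LA /(subvP sKL) LB; apply: rhoL.
have [j vj] : exists j, v 0 j != 0 by apply/rV0Pn.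
(* The weight is read off a nonzero coordinate of v, which makes it linear. *)
pose lam (M : 'M_k) := (v *m M) 0 j / v 0 j.
have lamE A : A \in K -> v *m rho A = lam (rho A) *: v.
  move=> /Kv/sub_rVP[a va].
  by rewrite /lam va !mxE mulfK.
pose W := (\bigcap_(i < \dim K)
  eigenspace (rho (vbasis K)`_i) (lam (rho (vbasis K)`_i)))%MS.
have WP (w : 'rV_k) :
    reflect (forall A, A \in K -> w *m rho A = lam (rho A) *: w) (w <= W)%MS.
  apply: (iffP sub_bigcapmxP) => [Ww A KA | Ww i _]; last first.
    by apply/eigenspaceP/Ww/vbasis_mem/mem_nth; rewrite size_tuple.
  rewrite /lam (coord_vbasis KA) !linear_sum /= summxE.
  rewrite mulr_suml scaler_suml; apply: eq_bigr => i _.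
  rewrite !linearZ /= (eigenspaceP (Ww i isT)) /lam.
  by rewrite scalerA mulrA; congr (_ * _ *: _); rewrite [RHS]mxE.
have vW : (v <= W)%MS by apply/WP.
have stW : stablemx W (rho X).
  apply/row_subP => i; rewrite row_mul; move: (row i W) (row_sub i W) => w Ww.
  have [->|w0] := eqVneq w 0; first by rewrite mul0mx sub0mx.
  have /WP Kw := Ww; apply/WP => A KA.
  pose S M := exists2 A, A \in K & M = rho A.
  have SX M : S M -> S (lie_bracket (rho X) M).
    by case=> B KB ->; exists (lie_bracket X B); rewrite ?LX // rhoL // (subvP sKL).
  have Sw M : S M -> w *m M = lam M *: w by case=> B KB ->; apply: Kw.
  have F0 : [pchar F] =i pred0 by apply: Num.Theory.pchar_num.
  have SA : S (rho A) by exists A.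
  have lam0 := weight_bracket0 F0 w0 SX Sw SA.
  rewrite -mulmxA (_ : rho X *m rho A = rho A *m rho X + lie_bracket (rho X) (rho A)).
    by rewrite mulmxDr mulmxA Kw // -scalemxAl (Sw _ (SX _ SA)) lam0 scale0r addr0.
  by rewrite [RHS]addrC subrK.
have [] := @common_eigenvector _ _ [:: restrictmx W (rho X)] (_ : 0 < \rank W)%N.
- rewrite lt0n mxrank_eq0; apply: contraNneq v0 => W0; by rewrite -submx0 -W0.
- by move=> _ _ /[!inE] /eqP-> /eqP->.
move=> u u0 /=; rewrite andbT stablemx_restrict // => uX.
exists (u *m row_base W); first by rewrite mulmx_free_eq0 ?row_base_free.
move=> A; rewrite defL => /memv_addP[_ /vlineP[a ->] [B KB ->]].
rewrite linearD linearZ /= mulmxDr -scalemxAr addmx_sub ?scalemx_sub //.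
have /WP-> // : (u *m row_base W <= W)%MS by rewrite mulmx_sub // eq_row_base.
exact: scalemx_sub.
Qed.

Section QuotientEigenvector.
Variables (F : numClosedFieldType) (n : nat) (L : {vspace 'M[F]_n}).
Hypothesis (solL : lie_solvable L) (subL : (lie_prod L L <= L)%VS).

(** Lie's theorem on W / U, which is modelled by a complement C of U in W: a left
    inverse P of C that kills U turns A into the matrix C A P of its action on
    the quotient, and this is multiplicative on matrices that stabilize U and W. *)
Lemma lie_common_eigenvector_mod m1 m2 (U : 'M[F]_(m1, n)) (W : 'M[F]_(m2, n)) :
    (U < W)%MS ->
    (forall A, A \in L -> (U *m A <= U)%MS) ->
    (forall A, A \in L -> (W *m A <= W)%MS) ->
  exists w : 'rV_n, [/\ (w <= W)%MS, ~~ (w <= U)%MS &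
    forall A, A \in L -> (w *m A <= U + w)%MS].
Proof.
move=> ltUW stU stW.
pose C := row_base (W :\: U)%MS; pose D := row_base U.
have subWUC : (W <= U + C)%MS.
  have subW : (W <= W :\: U + W :&: U)%MS by rewrite addsmx_diff_cap_eq.
  by apply: submx_trans subW _; rewrite addsmxC addsmxS ?capmxSr ?eq_row_base.
have subCW : (C <= W)%MS by rewrite eq_row_base diffmxSl.
have CU0 : (C :&: U)%MS = 0.
  by apply/eqP; rewrite -submx0 -(capmx_diff W U) capmxS ?eq_row_base.
have freeCD : row_free (col_mx C D).
  rewrite /row_free -addsmxE mxrank_disjoint_sum ?mxrank_gen.
    by rewrite !eq_row_base.
  by apply/eqP; rewrite -submx0 -CU0 capmxS ?eq_row_base.
pose P := lsubmx (pinvmx (col_mx C D)).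
have [CP DP] : C *m P = 1%:M /\ D *m P = 0.
  have := mulmxVp freeCD; rewrite -[pinvmx _]hsubmxK -/P mul_col_mx !mul_mx_row.
  by rewrite (scalar_mx_block _ _ 1) => /eq_block_mx[].
have UP : U *m P = 0.
  have /submxP[z defU] : (U <= D)%MS by rewrite eq_row_base.
  by rewrite [X in X *m P]defU -mulmxA DP mulmx0.
pose rho : {linear 'M[F]_n -> 'M[F]__} := mulmxr P \o mulmx C.
have modU m (u : 'M_(m, n)) : (u <= W)%MS -> exists y, u = u *m P *m C + y *m U.
  move=> /submx_trans/(_ subWUC)/sub_addsmxP[[x y] ->] /=; exists x.
  by rewrite mulmxDl -(mulmxA x) -(mulmxA y) UP CP mulmx0 add0r mulmx1 addrC.
have rhoM A B : A \in L -> B \in L -> rho (A *m B) = rho A *m rho B.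
  move=> LA LB; rewrite /rho /= /mulmxr.
  have [y CA] := modU _ (C *m A) (submx_trans (submxMr A subCW) (stW _ LA)).
  rewrite (mulmxA C A) [in LHS]CA !mulmxDl -!mulmxA.
  rewrite [X in y *m X](_ : _ = 0) ?mulmx0 ?addr0 //.
  have /submxP[z UB] := stU _ LB.
  by rewrite mulmxA UB -mulmxA UP mulmx0.
have [||v v0 vL] := @lie_common_eigenvector F n _ rho L _ solL subL.
- rewrite lt0n; apply/eqP => C0.
  have W_U : (W <= U)%MS.
    apply: submx_trans subWUC _; rewrite addsmx_sub submx_refl /=.
    by rewrite -[C]mul1mx -CP; apply/row_subP => i; have := ltn_ord i; rewrite {2}C0.
  by move: ltUW; rewrite ltmxE W_U andbF.
- move=> A B LA LB; rewrite /lie_bracket linearB /=; congr (_ - _); exact: rhoM.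
exists (v *m C); split.
- exact: mulmx_sub.
- by apply: contraNN v0 => /(submxMr P); rewrite UP -mulmxA CP mulmx1 => /submx0null->.
- move=> A LA; have /submxP[a vA] := vL A LA.
  have [y ->] := modU _ (v *m C *m A)
    (submx_trans (submxMr A (mulmx_sub v subCW)) (stW _ LA)).
  have -> : v *m C *m A *m P = a *m v by rewrite -vA /= /mulmxr !mulmxA.
  by rewrite addrC -(mulmxA a) addmx_sub_adds ?submxMl.
Qed.
End QuotientEigenvector.

(** * Extending Lagrangian bases *)

Section SymplecticForm.
Variables (F : fieldType) (r : nat).
Local Notation J := (symplectic_form F r).

Lemma symplectic_formK : J *m J = - 1%:M.
Proof.
rewrite mulmx_block !(mul0mx, mulmx0, mulmx1, mul1mx, addr0, add0r).
by rewrite scalar_mx_block opp_block_mx !oppr0.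
Qed.

Lemma tr_symplectic_form : J^T = - J.
Proof. by rewrite tr_block_mx !linear0 !linearN /= trmx1 opp_block_mx !oppr0 opprK. Qed.

Lemma symplectic_form_unit : J \in unitmx.
Proof.
by case: (@mulmx1_unit _ _ J (- J)); rewrite // mulmxN symplectic_formK opprK.
Qed.

(** Membership in [sp] is stated for column vectors, while the flags below are
    flags of row vectors: J^-1 = - J exchanges the two. *)
Lemma mem_sp_row A : (A \in sp F r) = (A *m J + J *m A^T == 0).
Proof.
rewrite mem_sp -(inj_eq (can_inj (mulKmx symplectic_form_unit))).
rewrite -(inj_eq (can_inj (mulmxK symplectic_form_unit))) mulmx0 mul0mx.
rewrite mulmxDr mulmxDl !mulmxA symplectic_formK -2!mulmxA symplectic_formK.
by rewrite mulmxN mulmx1 !mulNmx mul1mx mulmxN -opprD oppr_eq0 addrC.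
Qed.

Lemma tr_form_row m k (E : 'M[F]_(m, r + r)) (G : 'M_(k, r + r)) :
  (E *m J *m G^T)^T = - (G *m J *m E^T).
Proof. by rewrite !trmx_mul trmxK tr_symplectic_form mulNmx mulmxN mulmxA. Qed.

(** Any G0 dual to E can be made isotropic by adding a multiple of E: the Gram
    matrix of G0 + S E is that of G0 plus S - S^T, and the Gram matrix of G0 is
    antisymmetric, so minus one half of it is a suitable S. *)
Lemma lagrangian_extend (E : 'M[F]_(r, r + r)) : 2%:R != 0 :> F ->
    row_free E -> E *m J *m E^T = 0 ->
  exists G, col_mx E G *m J *m (col_mx E G)^T = J.
Proof.
move=> two_neq0 freeE isoE.
have [G0 EG0] : exists G0 : 'M_(r, r + r), E *m J *m G0^T = 1%:M.
  exists (pinvmx (E *m J))^T; rewrite trmxK mulmxVp //.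
  by rewrite /row_free mxrankMfree // row_free_unit symplectic_form_unit.
pose S := - (2%:R^-1 *: (G0 *m J *m G0^T)).
have GE0 : G0 *m J *m E^T = - 1%:M by rewrite -[LHS]opprK -tr_form_row EG0 trmx1.
exists (G0 + S *m E).
rewrite mul_col_mx tr_col_mx mul_col_row isoE.
rewrite !mulmxDl linearD /= !mulmxDr trmx_mul !mulmxA EG0 isoE GE0.
have SEJ m (M : 'M_(_, m)) : S *m E *m J *m M = S *m (E *m J *m M) by rewrite !mulmxA.
rewrite !SEJ isoE EG0 !mulmx0 !mul0mx mulmx1 !addr0 mulNmx mul1mx; congr block_mx.
rewrite /S linearN linearZ /= tr_form_row scalerN opprK -addrA -opprD -scalerDl.
by rewrite -[_ + 2%:R^-1]mulr2n -[2%:R^-1 *+ 2]mulr_natr mulVf // scale1r subrr.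
Qed.

End SymplecticForm.

(** * Stable isotropic flags *)

Section IsotropicFlag.
Variables (F : numClosedFieldType) (r : nat) (L : {vspace 'M[F]_(r + r)}).
Local Notation J := (symplectic_form F r).
Hypothesis (solL : lie_solvable L) (subL : (lie_prod L L <= L)%VS).
Hypothesis Lsp : (L <= sp F r)%VS.

(** The rows of E span the members of the flag, one new row at each step, so that
    stability means that L acts by lower triangular matrices. The new row is an
    eigenvector modulo E inside W, the orthogonal of E, which is strictly larger
    than E as long as k < r. *)
Lemma stable_isotropic_flag k : (k <= r)%N ->
  exists E : 'M[F]_(k, r + r), [/\ row_free E, E *m J *m E^T = 0 &
    forall A, A \in L -> exists2 T, is_trig_mx T & E *m A = T *m E].
Proof.
elim: k => [|k IHk] lt_kr.
  exists 0; split; first by rewrite /row_free mxrank0.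
    by rewrite trmx0 mulmx0.
  move=> A _; exists 0; last by rewrite !mul0mx.
  by apply/is_trig_mxP => -[].
have [E [freeE isoE stE]] := IHk (ltnW lt_kr).
pose W := kermx (J *m E^T).
have WP m (u : 'M_(m, r + r)) : (u <= W)%MS = (u *m J *m E^T == 0).
  by rewrite sub_kermx mulmxA.
have ltEW : (E < W)%MS.
  rewrite ltmxErank WP isoE eqxx (eqP freeE) /W mxrank_ker.
  have := rank_leq_col (J *m E^T); rewrite ltn_subRL => le_k.
  exact: leq_ltn_trans (leq_add le_k (leqnn k)) (leq_add lt_kr (ltnW lt_kr)).
have [||w [wW wE wL]] := lie_common_eigenvector_mod solL subL ltEW.
- by move=> A /stE[T _ ->]; apply: submxMl.
- move=> A LA; rewrite WP.
  have /eqP := subvP Lsp _ LA; rewrite mem_sp_row addr_eq0 => /eqP AJ.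
  have [T _ EA] := stE A LA.
  rewrite -(mulmxA W) (eqP AJ) mulmxN mulNmx oppr_eq0 mulmxA -mulmxA -trmx_mul EA.
  have /eqP WJE : W *m J *m E^T == 0 by rewrite -WP.
  by rewrite trmx_mul mulmxA WJE mul0mx.
have wJE : w *m J *m E^T = 0 by apply/eqP; rewrite -WP.
have EJw : E *m J *m w^T = 0 by rewrite -[LHS]trmxK tr_form_row wJE oppr0 trmx0.
have wJw : w *m J *m w^T = 0.
  have := tr_form_row w w; move: (w *m J *m w^T) => x.
  move/matrixP/(_ 0 0)/eqP; rewrite !mxE -subr_eq0 opprK -mulr2n
    Num.Theory.mulrn_eq0 /= => /eqP x0.
  by apply/matrixP => i j; rewrite !ord1 x0 mxE.
rewrite -addn1; exists (col_mx E w); split.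
- rewrite /row_free -addsmxE mxrank_disjoint_sum ?(eqP freeE).
    by rewrite rank_rV (contraNneq _ wE) ?addn1 // => ->; rewrite sub0mx.
  apply/eqP/rowV0P => u /[!sub_capmx] /andP[uE /sub_rVP[a uw]].
  have [a0|a0] := eqVneq a 0; first by rewrite uw a0 scale0r.
  by case/negP: wE; rewrite -[w]scale1r -(mulVf a0) -scalerA -uw scalemx_sub.
- by rewrite mul_col_mx tr_col_mx mul_col_row isoE EJw wJE wJw block_mx0.
- move=> A LA; have [T trigT EA] := stE A LA.
  have /sub_addsmxP[[x y] /= wA] := wL A LA.
  exists (block_mx T 0 x y).
    rewrite is_trig_block_mx // eqxx trigT /=.
    by apply/is_trig_mxP => i j; rewrite !ord1.
  by rewrite mul_col_mx mul_block_col mul0mx addr0 EA wA.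
Qed.

End IsotropicFlag.

(** * Conjugation *)

Section Conjugation.
Variables (F : fieldType) (n : nat).
Implicit Types (P A B : 'M[F]_n) (U V b I : {vspace 'M[F]_n}).

Definition conjug P : 'End('M[F]_n) := linfun (mulmxr (invmx P) \o mulmx P).

Lemma conjugE P A : conjug P A = P *m A *m invmx P.
Proof. by rewrite lfunE. Qed.

Lemma conjugK P : P \in unitmx -> cancel (conjug P) (conjug (invmx P)).
Proof. by move=> uP A; rewrite !conjugE invmxK !mulmxA mulVmx // mul1mx mulmxKV. Qed.

Lemma conjug_imgK P U : P \in unitmx -> (conjug (invmx P) @: (conjug P @: U))%VS = U.
Proof.
move=> uP; rewrite -limg_comp -[RHS](lim1g U); congr (_ @: _)%VS.
by apply/lfunP => A; rewrite comp_lfunE conjugK // id_lfunE.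
Qed.

Lemma conjug_imgVK P U : P \in unitmx -> (conjug P @: (conjug (invmx P) @: U))%VS = U.
Proof. by move=> uP; rewrite -{1}[P]invmxK conjug_imgK // unitmx_inv. Qed.

Lemma dim_conjug P U : P \in unitmx -> \dim (conjug P @: U) = \dim U.
Proof.
move=> uP; apply: limg_dim_eq; apply/eqP; rewrite -subv0; apply/subvP => A.
rewrite memv_cap memv_ker memv0 => /andP[_ /eqP PA0].
by rewrite -(conjugK uP A) PA0 linear0.
Qed.

Lemma conjug_bracket P A B : P \in unitmx ->
  conjug P (lie_bracket A B) = lie_bracket (conjug P A) (conjug P B).
Proof.
move=> uP; rewrite /lie_bracket linearB /= !conjugE.
by rewrite !mulmxA !mulmxKV // -!mulmxA.
Qed.

Lemma conjug_lie_prod P U V : P \in unitmx ->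
  (conjug P @: lie_prod U V)%VS = lie_prod (conjug P @: U) (conjug P @: V).
Proof.
move=> uP; apply/eqP; rewrite eqEsubv; apply/andP; split.
  apply/subvP => _ /memv_imgP[C UVC ->]; rewrite memv_preim.
  apply: subvP C UVC; apply/lie_prodP => A B UA VB.
  by rewrite -memv_preim conjug_bracket // mem_lie_prod // memv_img.
apply/lie_prodP => _ _ /memv_imgP[A UA ->] /memv_imgP[B VB ->].
by rewrite -conjug_bracket // memv_img // mem_lie_prod.
Qed.

Lemma conjug_solvable P U : P \in unitmx -> lie_solvable U ->
  lie_solvable (conjug P @: U).
Proof.
move=> uP [k k0]; exists k; rewrite -[RHS](limg0 (conjug P)) -k0.
by elim: k {k0} => //= k ->; rewrite conjug_lie_prod.
Qed.

Lemma conjug_abelian_ideal P b I : P \in unitmx ->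
  abelian_ideal b I -> abelian_ideal (conjug P @: b) (conjug P @: I).
Proof.
move=> uP [[sIb sbI] abI]; split; first split; first exact: limgS.
  by rewrite -conjug_lie_prod // limgS.
by rewrite /lie_abelian -conjug_lie_prod // abI limg0.
Qed.
End Conjugation.

(** * Solvability of triangular matrices *)

Section Triangular.
Variables (F : fieldType) (n : nat) (h : 'I_n -> nat).
Implicit Types (A B : 'M[F]_n).

(** Triangularity is relative to an arbitrary height h, because the natural order
    of the indices is reversed in the second half of a symplectic basis;
    [tri k] is the k-th step of the filtration by height. *)
Definition truncate_below k A : 'M[F]_n :=
  \matrix_(p, q) (if (h p < h q + k)%N then A p q else 0).

Lemma truncate_below_linear k : linear (truncate_below k).
Proof.
by move=> a A B; apply/matrixP => p q; rewrite !mxE; case: ifP => _;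
  rewrite ?mulr0 ?addr0.
Qed.

HB.instance Definition _ k := GRing.isLinear.Build F 'M[F]_n 'M[F]_n *:%R
  (truncate_below k) (truncate_below_linear k).

Definition tri k : {vspace 'M[F]_n} := lker (linfun (truncate_below k)).

Lemma triP k A :
  reflect (forall p q, (h p < h q + k)%N -> A p q = 0) (A \in tri k).
Proof.
rewrite memv_ker lfunE; apply: (iffP eqP) => [/matrixP A0 p q ltpq|A0].
  by have := A0 p q; rewrite !mxE ltpq.
by apply/matrixP => p q; rewrite !mxE; case: ifP => // /A0.
Qed.

Lemma tri_mul k l A B : A \in tri k -> B \in tri l -> A *m B \in tri (k + l).
Proof.
move=> /triP A0 /triP B0; apply/triP => p q lt_pq; rewrite mxE big1 // => s _.
have [lt_ps|le_sp] := ltnP (h p) (h s + k); first by rewrite A0 ?mul0r.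
rewrite (B0 s q) ?mulr0 //.
by rewrite -(ltn_add2r k) (leq_ltn_trans le_sp) // -addnA (addnC l).
Qed.

Lemma tri_le k l : (k <= l)%N -> (tri l <= tri k)%VS.
Proof.
move=> le_kl; apply/subvP => A /triP A0; apply/triP => p q lt_pq.
by apply: A0; apply: leq_trans lt_pq _; rewrite leq_add2l.
Qed.

Lemma lie_prod_tri k l : (lie_prod (tri k) (tri l) <= tri (k + l))%VS.
Proof.
apply/lie_prodP => A B Ak Bl; apply: rpredB; first exact: tri_mul.
by rewrite addnC; apply: tri_mul.
Qed.

Hypothesis h_inj : injective h.

Lemma tri_mul_diag A B p : A \in tri 0 -> B \in tri 0 -> (A *m B) p p = A p p * B p p.
Proof.
move=> /triP A0 /triP B0; rewrite mxE (bigD1 p) //= big1 ?addr0 // => s ps.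
have [lt|lt|/h_inj eq_ps] := ltngtP (h p) (h s); last by rewrite eq_ps eqxx in ps.
  by rewrite A0 ?mul0r ?addn0.
by rewrite B0 ?mulr0 ?addn0.
Qed.

(** The diagonal parts of two triangular matrices commute. *)
Lemma lie_prod_tri0 : (lie_prod (tri 0) (tri 0) <= tri 1)%VS.
Proof.
apply/lie_prodP => A B A0 B0; apply/triP => p q.
rewrite addn1 ltnS leq_eqVlt => /orP[/eqP/h_inj<-|lt_pq].
  have -> : lie_bracket A B p p = (A *m B) p p - (B *m A) p p by rewrite !mxE.
  by rewrite !tri_mul_diag // mulrC subrr.
by have /triP-> := subvP (lie_prod_tri 0 0) _ (mem_lie_prod A0 B0); rewrite ?addn0.
Qed.

Lemma tri_solvable : lie_solvable (tri 0).
Proof.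
have der k : (lie_derived_series k.+1 (tri 0) <= tri k.+1)%VS.
  elim: k => [|k IHk]; first exact: lie_prod_tri0.
  apply: subv_trans (lie_prodS IHk IHk) (subv_trans (lie_prod_tri _ _) (tri_le _)).
  by rewrite addSn ltnS leq_addl.
exists (\max_p h p).+1; apply/eqP; rewrite -subv0; apply: subv_trans (der _) _.
apply/subvP => A /triP A0; rewrite memv0; apply/eqP/matrixP => p q; rewrite mxE.
by apply: A0; rewrite addnS ltnS (leq_trans (leq_bigmax p)) ?leq_addl.
Qed.

End Triangular.

(** * The standard Borel subalgebra *)

Section StandardBorel.
Variables (F : fieldType) (r : nat).
Local Notation J := (symplectic_form F r).

(** The position of a basis vector in the complete flag that refines the standard
    isotropic flag: the second half of the basis is dual to the first, hence
    comes in reverse order. *)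
Definition height (p : 'I_(r + r)) : nat :=
  match fintype.split p with inl i => i | inr j => r + rev_ord j end.

Lemma height_lshift (i : 'I_r) : height (lshift r i) = i.
Proof. by rewrite /height (unsplitK (inl i)). Qed.

Lemma height_rshift (j : 'I_r) : height (rshift r j) = (r + rev_ord j)%N.
Proof. by rewrite /height (unsplitK (inr j)). Qed.

Lemma height_inj : injective height.
Proof.
move=> p q; rewrite -(splitK p) -(splitK q).
case: (fintype.split p) (fintype.split q) => i [] j;
  rewrite /= ?height_lshift ?height_rshift => eq_ij.
- by congr lshift; apply: val_inj.
- by have := ltn_ord i; rewrite eq_ij ltnNge leq_addr.
- by have := ltn_ord j; rewrite -eq_ij ltnNge leq_addr.
- by congr rshift; apply/rev_ord_inj/val_inj/(addnI eq_ij).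
Qed.

Definition std_borel : {vspace 'M[F]_(r + r)} := (sp F r :&: tri F height 0)%VS.

Lemma mem_sp_block (a b c d : 'M[F]_r) :
  (block_mx a b c d \in sp F r) = [&& d == - a^T, b^T == b & c^T == c].
Proof.
rewrite mem_sp tr_block_mx !mulmx_block !(mul0mx, mulmx0, mul1mx, mulmx1, add0r, addr0).
rewrite !mulmxN !mulmx1 !mulNmx !mul1mx add_block_mx.
apply/eqP/and3P => [E|[/eqP-> /eqP-> /eqP->]].
  have {E} : block_mx (- c^T + c) (a^T + d) (- d^T - a) (b^T - b) = block_mx 0 0 0 0.
    by rewrite E block_mx0.
  case/eq_block_mx => c0 ad0 _ b0; split.
  - by rewrite -addr_eq0 addrC ad0.
  - by rewrite -subr_eq0 b0.
  - by rewrite eq_sym -subr_eq0 addrC c0.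
by rewrite !linearN /= trmxK opprK !(addNr, subrr, addrN) block_mx0.
Qed.

Lemma std_borelP A :
  reflect (exists T S, [/\ is_trig_mx T, S^T = S & A = block_mx T 0 S (- T^T)])
          (A \in std_borel).
Proof.
rewrite memv_cap; apply: (iffP andP) => [[]|[T [S [/is_trig_mxP trigT symS ->]]]].
  rewrite -[A]submxK mem_sp_block => /and3P[/eqP-> _ /eqP symS] /triP triA.
  exists (ulsubmx A), (dlsubmx A); split=> //.
    apply/is_trig_mxP => i j lt_ij; have := triA (lshift r i) (lshift r j).
    by rewrite !height_lshift addn0 block_mxEul; apply.
  congr block_mx; apply/matrixP => i j; have := triA (lshift r i) (rshift r j).
  rewrite height_lshift height_rshift addn0 block_mxEur => ->; first by rewrite mxE.
  exact: leq_trans (ltn_ord i) (leq_addr _ _).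
rewrite mem_sp_block eqxx trmx0 symS !eqxx; split=> //; apply/triP => p q.
rewrite -(splitK p) -(splitK q) addn0.
case: (fintype.split p) (fintype.split q) => i [] j /=;
  rewrite ?height_lshift ?height_rshift => lt_pq.
- by rewrite block_mxEul trigT.
- by rewrite block_mxEur mxE.
- by have := ltn_trans lt_pq (ltn_ord j); rewrite ltnNge leq_addr.
rewrite block_mxEdr !mxE trigT ?oppr0 //.
by move: lt_pq; rewrite ltn_add2l /= ltn_sub2lE.
Qed.

Lemma std_borel_solvable : lie_solvable std_borel.
Proof. exact: lie_solvableS (capvSr _ _) (tri_solvable F height_inj). Qed.

Lemma sp_bracket A B : A \in sp F r -> B \in sp F r -> lie_bracket A B \in sp F r.
Proof.
rewrite !mem_sp !addr_eq0 => /eqP A0 /eqP B0.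
have swap (X Y : 'M[F]_(r + r)) : X^T *m J = - (J *m X) -> Y^T *m J = - (J *m Y) ->
    (X *m Y)^T *m J = J *m (Y *m X).
  by move=> X0 Y0; rewrite trmx_mul -mulmxA X0 mulmxN (mulmxA Y^T) Y0 mulNmx opprK
    mulmxA.
by rewrite /lie_bracket linearB mulmxBl mulmxBr !swap // opprB.
Qed.

Lemma std_borel_subalgebra : lie_subalgebra (sp F r) std_borel.
Proof.
split; first exact: capvSl.
apply/lie_prodP => A B; rewrite !memv_cap => /andP[Asp At] /andP[Bsp Bt].
by rewrite sp_bracket // (subvP (lie_prod_tri F height 0 0)) // mem_lie_prod.
Qed.

Lemma sp_conjug P A : P *m J *m P^T = J -> P \in unitmx ->
  A \in sp F r -> conjug P A \in sp F r.
Proof.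
move=> PJ uP; rewrite !mem_sp_row conjugE => /eqP AJ.
have PVJ : invmx P *m J = J *m P^T by rewrite -{1}PJ -mulmxA mulKmx.
have JPV : J *m (invmx P)^T = P *m J.
  by rewrite -{1}PJ -mulmxA -trmx_mul mulVmx // trmx1 mulmx1.
rewrite !trmx_mul !mulmxA JPV -(mulmxA (P *m A)) PVJ !mulmxA.
have -> : P *m A *m J *m P^T + P *m J *m A^T *m P^T = P *m (A *m J + J *m A^T) *m P^T.
  by rewrite mulmxDr mulmxDl !mulmxA.
by rewrite AJ mulmx0 mul0mx.
Qed.

Lemma symplectic_inv P : P *m J *m P^T = J -> P \in unitmx ->
  invmx P *m J *m (invmx P)^T = J.
Proof.
move=> PJ uP; rewrite -{1}PJ !mulmxA mulVmx // mul1mx -mulmxA -trmx_mul mulVmx //.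
by rewrite trmx1 mulmx1.
Qed.

Lemma symplectic_unit P : P *m J *m P^T = J -> P \in unitmx.
Proof.
move=> PJ; case: (@mulmx1_unit _ _ P (- (J *m P^T *m J))) => //.
by rewrite mulmxN !mulmxA PJ symplectic_formK opprK.
Qed.

End StandardBorel.

(** In a symplectic basis adapted to a stable isotropic flag, b is contained in
    [std_borel]; maximality of b among the solvable subalgebras gives equality. *)
Theorem borel_conjugate (F : numClosedFieldType) r (b : {vspace 'M[F]_(r + r)}) :
    borel_subalgebra (sp F r) b ->
  exists2 P, P \in unitmx & (conjug P @: b)%VS = std_borel F r.
Proof.
case=> [[b_sp b_lie] b_sol b_max].
have [E [freeE isoE stE]] := stable_isotropic_flag b_sol b_lie b_sp (leqnn r).
have two_neq0 : 2%:R != 0 :> F by rewrite Num.Theory.pnatr_eq0.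
have [G PJ] := lagrangian_extend two_neq0 freeE isoE.
set P := col_mx E G in PJ; have uP := symplectic_unit PJ; exists P => //.
have sub_std : (conjug P @: b <= std_borel F r)%VS.
  apply/subvP => _ /memv_imgP[A bA ->].
  have := sp_conjug PJ uP (subvP b_sp _ bA).
  have [T trigT EA] := stE A bA.
  have [] : ulsubmx (conjug P A) = T /\ ursubmx (conjug P A) = 0.
    have : conjug P A *m P = P *m A by rewrite conjugE mulmxKV.
    rewrite -{1}[conjug P A]submxK mul_block_col mul_col_mx EA => /eq_col_mx[EB _].
    by apply/eq_row_mx/(can_inj (mulmxK uP)); rewrite !mul_row_col EB mul0mx addr0.
  move=> ulE urE; have := submxK (conjug P A); rewrite ulE urE.
  move: (dlsubmx _) (drsubmx _) => S D <-.
  rewrite mem_sp_block => /and3P[/eqP-> _ /eqP symS].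
  by apply/std_borelP; exists T, S.
pose b' := (conjug (invmx P) @: std_borel F r)%VS.
have uP' : invmx P \in unitmx by rewrite unitmx_inv.
suffices <- : b' = b by rewrite conjug_imgVK.
apply: b_max.
- have [s_sp s_lie] := std_borel_subalgebra F r; split; last first.
    by rewrite -conjug_lie_prod // limgS.
  apply/subvP => _ /memv_imgP[A /(subvP s_sp) spA ->].
  by apply: sp_conjug => //; apply: symplectic_inv.
- by apply: conjug_solvable => //; apply: std_borel_solvable.
- by rewrite -(conjug_imgK b uP) limgS.
Qed.

(** * Strict partitions and their shapes *)

(** The recursion on whether the part r occurs is the one by which [f_C] picks up
    the factor 1 + t^r. *)
Fixpoint strict_partitions r : seq (seq nat) :=
  if r is r'.+1 then
    strict_partitions r' ++ [seq r :: l | l <- strict_partitions r']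
  else [:: [::]].

(** The self-conjugate diagram whose k-th principal hook has arm and leg of length
    [nth 0 l k], counting the corner in both: cells on or above the diagonal
    form the shifted diagram with row lengths l. *)
Fixpoint shape (l : seq nat) (i j : nat) : bool :=
  if l is k :: l' then
    (if i is i'.+1 then if j is j'.+1 then shape l' i' j' else (i < k)%N else (j < k)%N)
  else false.

Lemma shapeC l i j : shape l i j = shape l j i.
Proof. by elim: l i j => [|k l IHl] [|i] [|j] //=. Qed.

Lemma shape_bound r l i j : l \in strict_partitions r -> shape l i j -> (i < r)%N.
Proof.
elim: r l i j => [|r IHr] l i j /=; first by rewrite inE => /eqP->.
rewrite mem_cat => /orP[/IHr sub /sub/ltnW //|/mapP[l' lr ->]].
by case: i j => [|i] [|j] //=; apply: IHr.
Qed.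

Lemma shape_lower r l i i' j : l \in strict_partitions r ->
  (i' <= i)%N -> shape l i j -> shape l i' j.
Proof.
elim: r l i i' j => [|r IHr] l i i' j /=; first by rewrite inE => /eqP->.
rewrite mem_cat => /orP[lr|/mapP[l' lr ->]]; first exact: IHr.
case: i i' j => [|i] [|i'] [|j] //=.
- by move=> _; rewrite shapeC => /(shape_bound lr); rewrite ltnS.
- exact: leq_trans.
- by rewrite ltnS; apply: IHr lr.
Qed.

(** The corner cell (r, 0) of the square detects the part r + 1. *)
Lemma shape_corner r l : shape (r.+1 :: l) r 0.
Proof. by case: r => [|r] /=. Qed.

Lemma shape_inj r : {in strict_partitions r &, forall l l',
  (forall i j, (i < r)%N -> (j < r)%N -> shape l i j = shape l' i j) -> l = l'}.
Proof.
elim: r => [|r IHr] l l' /=; first by rewrite !inE => /eqP-> /eqP->.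
have nobox m : m \in strict_partitions r -> shape m r 0 = false.
  by move=> mr; apply/negP => /(shape_bound mr); rewrite ltnn.
rewrite !mem_cat => /orP[lr|/mapP[m mr ->]] /orP[lr'|/mapP[m' mr' ->]] eq_shape.
- by apply: IHr => // i j ir jr; apply: eq_shape; apply: leq_trans (leqnSn r).
- by have := eq_shape r 0%N (leqnn _) isT; rewrite shape_corner nobox.
- by have := eq_shape r 0%N (leqnn _) isT; rewrite shape_corner nobox.
- by congr cons; apply: IHr => // i j ir jr; apply: (eq_shape i.+1 j.+1).
Qed.

Lemma uniq_strict_partitions r : uniq (strict_partitions r).
Proof.
elim: r => //= r IHr; rewrite cat_uniq IHr map_inj_uniq ?IHr ?andbT //=;
  last by move=> ? ? [].
apply/hasPn => _ /mapP[l _ ->]; apply/negP => /(@shape_bound _ _ r 0).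
by rewrite shape_corner ltnn => /(_ isT).
Qed.

(** The first row of D is either full, and then D is one hook around a smaller
    diagram, or misses its last cell, and then so do all rows. *)
Lemma shape_exists r (D : rel nat) :
    symmetric D -> (forall i j, D i j -> (i < r)%N) ->
    (forall i i' j, (i' <= i)%N -> D i j -> D i' j) ->
  exists2 l, l \in strict_partitions r & D =2 shape l.
Proof.
elim: r D => [|r IHr] D symD boundD lowD.
  by exists [::]; rewrite ?mem_head // => i j; apply/negP => /boundD.
case D0r: (D 0 r)%N.
  have [|||l lr Dl] := IHr (fun i j => D i.+1 j.+1).
  - by move=> i j; apply: symD.
  - by move=> i j /boundD.
  - by move=> i i' j le_i /=; apply: (lowD i.+1).
  have D0 j : D 0 j = (j < r.+1)%N.
    apply/idP/idP => [|]; first by rewrite symD; apply: boundD.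
    by rewrite ltnS symD => le_jr; apply: lowD le_jr _; rewrite symD.
  exists (r.+1 :: l); first by rewrite /= mem_cat map_f ?orbT.
  by case=> [|i] [|j] /=; rewrite ?D0 // ?Dl // symD D0.
have [//||//|l lr Dl] := IHr D.
  move=> i j Dij; have := boundD _ _ Dij; rewrite ltnS leq_eqVlt => /orP[/eqP eq_ir|//].
  by move: D0r; rewrite -eq_ir (lowD j 0%N i) // symD.
by exists l; rewrite //= mem_cat lr.
Qed.

(** The side N of the square is decoupled from r because the induction lowers r
    without shrinking the square when r does not occur in l. *)
Lemma shape_count r N l : l \in strict_partitions r -> (r <= N)%N ->
  (\sum_(i < N) \sum_(j < N) ((i <= j) && shape l i j) = sumn l)%N.
Proof.
elim: r l N => [|r IHr] l N /=.
  by rewrite inE => /eqP-> _; rewrite big1 // => i _; rewrite big1 // => j _;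
    rewrite andbF.
rewrite mem_cat => /orP[lr /ltnW|/mapP[l' lr ->]]; first exact: IHr.
case: N => // N le_rN; rewrite big_ord_recl /=; congr (_ + _)%N.
  rewrite -[RHS]card_ord -sum1_card (big_ord_widen _ (fun=> 1%N) le_rN) [RHS]big_mkcond.
  by apply: eq_bigr => j _ /=; case: ltnP.
rewrite -(IHr l' N lr le_rN); apply: eq_bigr => i _.
by rewrite big_ord_recl /= add0n; apply: eq_bigr => j _; rewrite /bump /= !add1n.
Qed.

Lemma coef_f_C r m :
  ((f_C r)`_m)%R = count (fun l => sumn l == m) (strict_partitions r).
Proof.
elim: r m => [|r IHr] m.
  by rewrite /f_C big_nil coef1 /= addn0 eq_sym; case: eqP.
rewrite /f_C big_nat_recr //= -/(f_C r) mulrDr mulr1 coefD IHr coefMXn.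
rewrite count_cat count_map; congr (_ + _)%N.
case: ltnP => [lt_mr|le_rm].
  rewrite -[LHS](count_pred0 (strict_partitions r)); apply: eq_count => l /=.
  by apply/esym/eqP => eq_m; rewrite -eq_m ltnNge leq_addr in lt_mr.
rewrite IHr; apply: eq_count => l /=.
by rewrite -(eqn_add2l r.+1) subnKC.
Qed.

(** * Abelian ideals of the standard Borel subalgebra *)

Section LowerBlocks.
Variables (F : numFieldType) (r : nat).
Implicit Types (S T U : 'M[F]_r).

Definition lower_block S : 'M[F]_(r + r) := block_mx 0 0 S 0.

Lemma lower_block_linear : linear lower_block.
Proof.
by move=> a S U; rewrite /lower_block scale_block_mx add_block_mx !scaler0 !addr0.
Qed.

HB.instance Definition _ := GRing.isLinear.Build F 'M[F]_r 'M[F]_(r + r) *:%R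
  lower_block lower_block_linear.

Lemma lower_block_inj : injective lower_block.
Proof. by move=> S U /eq_block_mx[]. Qed.

Lemma bracket_lower_block T S U :
  lie_bracket (block_mx T 0 S (- T^T)) (lower_block U) =
    - lower_block (T^T *m U + U *m T).
Proof.
rewrite /lie_bracket !mulmx_block !(mul0mx, mulmx0, add0r, addr0).
rewrite opp_block_mx add_block_mx !oppr0 !addr0 mulNmx -opprD.
by rewrite -linearN.
Qed.

Lemma bracket_lower_lower S U : lie_bracket (lower_block S) (lower_block U) = 0.
Proof. by rewrite /lie_bracket !mulmx_block !(mul0mx, mulmx0, addr0) subrr. Qed.

(** Equal to 2 E_ii, not E_ii, when i = j. *)
Definition sym_unit i j : 'M[F]_r := delta_mx i j + delta_mx j i.

Lemma sym_unitC i j : sym_unit i j = sym_unit j i.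
Proof. exact: addrC. Qed.

Lemma tr_sym_unit i j : (sym_unit i j)^T = sym_unit i j.
Proof. by rewrite linearD /= !trmx_delta addrC. Qed.

Lemma sym_unitE i j p q :
  sym_unit i j p q = ((p == i) && (q == j))%:R + ((p == j) && (q == i))%:R.
Proof. by rewrite !mxE. Qed.

Lemma sym_unit_diag_neq0 i j : sym_unit i j i j != 0.
Proof.
rewrite sym_unitE !eqxx /= -natrD Num.Theory.pnatr_eq0 addn_eq0 //.
Qed.

Lemma lower_block_std S : S^T = S -> lower_block S \in std_borel F r.
Proof.
move=> symS; apply/std_borelP; exists 0, S; split=> //.
  by apply/is_trig_mxP => i j _; rewrite mxE.
by rewrite trmx0 oppr0.
Qed.

Lemma mulmx_diag_delta S i p q :
  (delta_mx i i *m S + S *m delta_mx i i) p q = S p q *+ ((p == i) + (q == i)).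
Proof.
rewrite !mxE mulrnDr; congr (_ + _).
  rewrite (bigD1 i) //= big1 ?addr0 => [|k ki]; rewrite !mxE ?eqxx ?andbT.
    by case: eqP => [->|_]; rewrite ?mul1r ?mul0r.
  by rewrite (negPf ki) andbF mul0r.
rewrite (bigD1 i) //= big1 ?addr0 => [|k ki]; rewrite !mxE ?eqxx /=.
  by case: eqP => [->|_]; rewrite ?mulr1 ?mulr0.
by rewrite (negPf ki) mulr0.
Qed.

Section AbelianIdeal.
Variable I : {vspace 'M[F]_(r + r)}.
Hypothesis abI : abelian_ideal (std_borel F r) I.

Lemma ideal_bracket A B : A \in std_borel F r -> B \in I -> lie_bracket A B \in I.
Proof. by case: abI => [[_ /lie_prodP bI] _]; apply: bI. Qed.

Lemma abelian_bracket A B : A \in I -> B \in I -> lie_bracket A B = 0.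
Proof.
case: abI => _ I0 AI BI; apply/eqP; rewrite -memv0.
by rewrite -I0 mem_lie_prod.
Qed.

(** Here V i is the symmetric block of the bracket of E_ii, placed in the lower
    left corner, with A; it lies in the ideal, so A commutes with it. Looking at the
    diagonal coefficients gives first 2 (T i j)^2 = 0 for j != i, then, T being
    diagonal, 4 (T i i)^2 = 0. *)
Lemma abelian_ideal_lower A : A \in I -> exists2 S, S^T = S & A = lower_block S.
Proof.
move=> AI; case: abI => [[/subvP/(_ A AI)/std_borelP[T [S [trigT symS defA]]] _] _].
exists S => //; suffices T0 : T = 0 by rewrite defA T0 trmx0 oppr0.
pose V i := T^T *m delta_mx i i + delta_mx i i *m T.
have VE i p q : V i p q = T i p *+ (q == i) + T i q *+ (p == i).
  rewrite !mxE; congr (_ + _).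
    rewrite (bigD1 i) //= big1 ?addr0 => [|k ki]; rewrite !mxE ?eqxx /=.
      by case: eqP; rewrite ?mulr1 ?mulr0.
    by rewrite (negPf ki) mulr0.
  rewrite (bigD1 i) //= big1 ?addr0 => [|k ki]; rewrite !mxE ?eqxx ?andbT.
    by case: eqP; rewrite ?mul1r ?mul0r.
  by rewrite (negPf ki) andbF mul0r.
have VT0 i : T^T *m V i + V i *m T = 0.
  have dI : lower_block (V i) \in I.
    have: lie_bracket (lower_block (delta_mx i i)) A \in I.
      by apply: ideal_bracket => //; apply: lower_block_std; rewrite trmx_delta.
    have -> : lie_bracket (lower_block (delta_mx i i)) A = lower_block (V i).
      by rewrite -[LHS]opprK /lie_bracket opprB -/(lie_bracket _ _) defA
        bracket_lower_block opprK.
    by [].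
  have := abelian_bracket AI dI; rewrite defA bracket_lower_block => /eqP.
  by rewrite oppr_eq0 => /eqP; rewrite -(linear0 lower_block) => /lower_block_inj.
clearbody V; have VT0E i j : \sum_k T k j * V i k j *+ 2 = 0.
  have /matrixP/(_ j j) := VT0 i; rewrite !mxE -big_split /= => VTjj;
    rewrite -[RHS]VTjj.
  apply: eq_bigr => k _; rewrite mxE mulr2n [V i j k * _]mulrC; congr (_ + _ * _).
  by rewrite !VE addrC.
have Toff i j : j != i -> T i j = 0.
  move=> ji; have /eqP := VT0E i j; rewrite (bigD1 i) //= big1 => [|k ki].
    rewrite VE eqxx (negPf ji) mulr0n add0r addr0 mulr1n.
    by rewrite Num.Theory.mulrn_eq0 /= mulf_eq0 orbb => /eqP.
  by rewrite VE (negPf ji) (negPf ki) !mulr0n addr0 mulr0 mul0rn.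
apply/matrixP => i j; rewrite mxE; have [->|] := eqVneq j i; last exact: Toff.
have /eqP := VT0E i i; rewrite (bigD1 i) //= big1 => [|k ki]; last first.
  by rewrite Toff 1?eq_sym // mul0r mul0rn.
rewrite VE eqxx mulr1n addr0 -mulr2n mulrnAr -mulrnA.
by rewrite Num.Theory.mulrn_eq0 /= mulf_eq0 orbb => /eqP.
Qed.

Lemma ideal_lower_act T U : is_trig_mx T -> lower_block U \in I ->
  lower_block (T^T *m U + U *m T) \in I.
Proof.
move=> trigT UI; rewrite -[lower_block _]opprK rpredN -(bracket_lower_block T 0).
apply: ideal_bracket => //; apply/std_borelP; exists T, 0; split=> //; exact: trmx0.
Qed.

Lemma delta_trig (i j : 'I_r) : (j <= i)%N -> is_trig_mx (delta_mx i j : 'M[F]_r).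
Proof.
move=> le_ji; apply/is_trig_mxP => p q lt_pq; rewrite mxE;
  case: andP => // -[/eqP pi /eqP qj].
by move: lt_pq; rewrite pi qj ltnNge le_ji.
Qed.

(** D k is the action of the diagonal matrix unit E_kk; it multiplies the (p, q)
    coefficient by the number of times k occurs in (p, q). Hence D i D j, corrected by
    D i when i = j, annihilates all coefficients but those at (i, j) and (j, i). *)
Lemma ideal_sym_unit S i j : S^T = S -> lower_block S \in I -> S i j != 0 ->
  lower_block (sym_unit i j) \in I.
Proof.
move=> symS SI Sij.
pose D k U : 'M[F]_r := delta_mx k k *m U + U *m delta_mx k k.
have DI k U : lower_block U \in I -> lower_block (D k U) \in I.
  by move=> UI; rewrite /D -{1}trmx_delta; apply: ideal_lower_act; rewrite ?delta_trig.
have: lower_block (D i (D j S) - D i S *+ (i == j)) \in I.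
  by rewrite raddfB raddfMn /= rpredB ?rpredMn ?DI.
suffices -> : D i (D j S) - D i S *+ (i == j) = S i j *: sym_unit i j.
  by rewrite linearZ /= rpredZeq (negPf Sij).
have Sji : S j i = S i j by rewrite -{1}symS mxE.
have DE k U p q : D k U p q = U p q *+ ((p == k) + (q == k)) by apply: mulmx_diag_delta.
clearbody D; apply/matrixP => p q; rewrite !mxE mulmxnE !DE.
have [->|pi] := eqVneq p i; have [->|qi] := eqVneq q i.
- by have [->|ij] := eqVneq i j; rewrite /= ?mulr0n; ring.
- by have [->|qj] := eqVneq q j; case: (i == j); rewrite /= ?mulr0n; ring.
- by have [->|qj] := eqVneq p j; rewrite ?Sji; case: (i == j); rewrite /= ?mulr0n; ring.
- by rewrite !mulr0n mul0rn subrr andbF addr0 mulr0.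
Qed.

Lemma ideal_sym_unit_lower (i i' j : 'I_r) : (i' <= i)%N ->
  lower_block (sym_unit i j) \in I -> lower_block (sym_unit i' j) \in I.
Proof.
move=> le_i SI; have := ideal_lower_act (delta_trig le_i) SI.
move/ideal_sym_unit; apply.
  by rewrite linearD /= !trmx_mul trmxK tr_sym_unit addrC.
rewrite trmx_delta /sym_unit !(mulmxDl, mulmxDr) !mul_delta_mx_cond !eqxx !mulr1n.
by rewrite !mxE !mulmxnE !mxE !eqxx -!mulrnA -!natrD Num.Theory.pnatr_eq0 !addn_eq0.
Qed.

End AbelianIdeal.

Lemma span_ind (vT : vectType F) (P : vT -> Prop) (X : seq vT) :
    P 0 -> (forall a u v, P u -> P v -> P (a *: u + v)) ->
    {in X, forall v, P v} -> {in <<X>>%VS, forall v, P v}.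
Proof.
move=> P0 PL; elim: X => [|x X IHX] PX v; first by rewrite span_nil memv0 => /eqP->.
rewrite span_cons => /memv_addP[_ /vlineP[a ->] [u uX ->]].
apply: PL; first by apply: PX; rewrite mem_head.
by apply: IHX uX => y yX; apply: PX; rewrite in_cons yX orbT.
Qed.

(** Linear forms phi that are dual to e up to nonzero factors; the factor is 2
    for the diagonal symmetric units. *)
Lemma free_dual (T : eqType) (vT : vectType F) (e : T -> vT)
    (phi : T -> {linear vT -> F^o}) (s : seq T) :
    uniq s -> {in s &, forall p q, (phi p (e q) != 0) = (p == q)} ->
  free (map e s).
Proof.
elim: s => [|p s IHs] /=; first by rewrite nil_free.
move=> /andP[ps us] phiE; rewrite free_cons IHs //; last first.
  by move=> q q' qs qs'; apply: phiE; rewrite in_cons ?qs ?qs' orbT.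
rewrite andbT; apply/negP => /(span_ind (P := fun v => phi p v = 0)).
move=> H; suff: phi p (e p) = 0 by apply/eqP; rewrite phiE ?mem_head ?eqxx.
apply: H.
- exact: linear0.
- by move=> a u v u0 v0; rewrite linearP u0 v0 scaler0 addr0.
- move=> _ /mapP[q qs ->]; apply/eqP/negbNE;
  rewrite phiE ?mem_head ?in_cons ?qs ?orbT //.
  by apply: contraNneq ps => ->.
Qed.

Definition shape_cells (l : seq nat) : seq ('I_r * 'I_r) :=
  [seq p : 'I_r * 'I_r <- enum {: 'I_r * 'I_r} | (p.1 <= p.2)%N && shape l p.1 p.2].

Definition shape_ideal l : {vspace 'M[F]_(r + r)} :=
  <<[seq lower_block (sym_unit p.1 p.2) | p <- shape_cells l]>>%VS.

Lemma sym_unit_shape_ideal l (i j : 'I_r) : shape l i j ->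
  lower_block (sym_unit i j) \in shape_ideal l.
Proof.
wlog le_ij : i j / (i <= j)%N.
  move=> gen; have [|/ltnW le_ji] := leqP i j; first exact: gen.
  by rewrite shapeC sym_unitC; apply: gen.
move=> lij; apply: memv_span; apply/mapP; exists (i, j) => //.
by rewrite mem_filter /= le_ij lij mem_enum.
Qed.

Lemma mem_shape_ideal l A :
  A \in shape_ideal l <-> exists S, [/\ S^T = S, A = lower_block S &
                                  forall i j, S i j != 0 -> shape l i j].
Proof.
split=> [|[S [symS -> lS]]].
  move: A; apply: span_ind.
  - exists 0; split; rewrite ?trmx0 ?linear0 // => i j; rewrite mxE eqxx //.
  - move=> a _ _ [S [symS -> lS]] [U [symU -> lU]]; exists (a *: S + U).
    split; [by rewrite linearP /= symS symU | by rewrite linearP |].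
    move=> i j; rewrite !mxE => nz.
    apply/negPn/negP => nl; case/eqP: nz.
    rewrite (eqP (negbNE (contraNN (lS i j) nl))) (eqP (negbNE (contraNN (lU i j) nl))).
    by rewrite mulr0 addr0.
  - move=> _ /mapP[[i j] + ->]; rewrite mem_filter => /andP[/andP[/= _ lij] _].
    exists (sym_unit i j); split; rewrite ?tr_sym_unit // => p q; rewrite sym_unitE.
    have [/andP[/eqP-> /eqP->] //|_] := boolP ((p == i) && (q == j)).
    have [/andP[/eqP-> /eqP->]|_] := boolP ((p == j) && (q == i));
      first by rewrite shapeC.
    by rewrite addr0 eqxx.
(* Summing over all pairs (i, j) counts each coefficient of S twice. *)
have -> : S = 2%:R^-1 *: \sum_i \sum_j S i j *: sym_unit i j.
  have -> : \sum_i \sum_j S i j *: sym_unit i j = S + S^T.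
    rewrite {2 3}(matrix_sum_delta S) linear_sum -big_split; apply: eq_bigr => i _ /=.
    rewrite linear_sum -big_split; apply: eq_bigr => j _ /=.
    by rewrite linearZ /= trmx_delta scalerDr.
  rewrite symS -mulr2n -scaler_nat scalerA mulVf ?scale1r //.
  by rewrite Num.Theory.pnatr_eq0.
rewrite linearZ memvZ // linear_sum memv_suml // => i _;
  rewrite linear_sum memv_suml // => j _.
have [->|/lS lij] := eqVneq (S i j) 0; first by rewrite scale0r linear0 mem0v.
by rewrite linearZ memvZ // sym_unit_shape_ideal.
Qed.

Lemma shape_idealE l (i j : 'I_r) :
  (lower_block (sym_unit i j) \in shape_ideal l) = shape l i j.
Proof.
apply/idP/idP => [/mem_shape_ideal[S [_ /lower_block_inj<- lS]]|];
  last exact: sym_unit_shape_ideal.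
exact/lS/sym_unit_diag_neq0.
Qed.

(** The generators are independent because each has a coefficient, at the cell it
    is attached to, where all others vanish. *)
Lemma dim_shape_ideal l : l \in strict_partitions r -> \dim (shape_ideal l) = sumn l.
Proof.
move=> lr; pose phi (p : 'I_r * 'I_r) (A : 'M[F]_(r + r)) : F^o :=
  A (rshift r p.1) (lshift r p.2).
have phi_lin p : linear (phi p) by move=> a A B; rewrite /phi !mxE.
pose phiL p : {linear 'M[F]_(r + r) -> F^o} :=
  HB.pack (phi p) (GRing.isLinear.Build _ _ _ _ (phi p) (phi_lin p)).
have -> : \dim (shape_ideal l) = size (shape_cells l).
  rewrite -(size_map (fun p => lower_block (sym_unit p.1 p.2))).
  apply/eqP; apply: (free_dual (phi := phiL)); first by rewrite filter_uniq ?enum_uniq.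
  move=> [i j] [i' j'] /=; rewrite !mem_filter =>
    /andP[/andP[/= le_ij _] _] /andP[/andP[/= le_ij' _] _].
  rewrite /phi /lower_block /= block_mxEdl sym_unitE -natrD Num.Theory.pnatr_eq0
    -lt0n addn_gt0 !lt0b xpair_eqE.
  apply/orP/idP => [[//|/andP[/eqP ij' /eqP ji']]|->]; last by left.
  have eq_ij : i = j by apply/val_inj/eqP; rewrite eqn_leq le_ij ij' ji' le_ij'.
  by rewrite -ij' -ji' eq_ij eqxx.
rewrite -(shape_count lr (leqnn r)) pair_bigA /= /shape_cells size_filter.
by rewrite -sum1_count big_enum_cond /= big_mkcond; apply: eq_bigr => -[i j] _ /=;
  case: (_ && _).
Qed.

Lemma shape_ideal_abelian l : l \in strict_partitions r ->
  abelian_ideal (std_borel F r) (shape_ideal l).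
Proof.
move=> lr; split; first split.
- by apply/subvP => _ /mem_shape_ideal[S [symS -> _]]; apply: lower_block_std.
- apply/lie_prodP => _ _ /std_borelP[T [S [/is_trig_mxP trigT _ ->]]]
  /mem_shape_ideal[U [symU -> lU]].
  rewrite bracket_lower_block rpredN; apply/mem_shape_ideal; exists (T^T *m U + U *m T).
  split=> // [|i j]; first by rewrite linearD /= !trmx_mul trmxK symU addrC.
  have low p q : (exists k : 'I_r, (q <= k)%N /\ U p k != 0) -> shape l p q.
    by case=> k [le_qk /lU]; rewrite shapeC => /(shape_lower lr le_qk); rewrite shapeC.
  have symUE p q : U p q = U q p by rewrite -{1}symU mxE.
  apply: contraNT => nl; rewrite !mxE !big1 ?addr0 // => k _.
    have [lt_kj|le_jk] := ltnP k j; first by rewrite trigT ?mulr0.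
    have [->|Uik] := eqVneq (U i k) 0; first by rewrite mul0r.
    by case/negP: nl; apply: low; exists k.
  rewrite mxE; have [lt_ki|le_ik] := ltnP k i; first by rewrite trigT ?mul0r.
  have [->|Ukj] := eqVneq (U k j) 0; first by rewrite mulr0.
  by case/negP: nl; rewrite shapeC; apply: low; exists k; rewrite symUE.
- apply/eqP; rewrite /lie_abelian -subv0; apply/lie_prodP.
  move=> _ _ /mem_shape_ideal[S [_ -> _]] /mem_shape_ideal[U [_ -> _]].
  by rewrite bracket_lower_lower mem0v.
Qed.

Lemma abelian_ideal_shape I : abelian_ideal (std_borel F r) I ->
  exists2 l, l \in strict_partitions r & I = shape_ideal l.
Proof.
move=> abI.
(* The combinatorics needs a relation on nat, false outside the square. *)
pose D (m k : nat) := [exists i : 'I_r, exists j : 'I_r,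
  [&& i == m :> nat, j == k :> nat & lower_block (sym_unit i j) \in I]].
have DE (i j : 'I_r) : D i j = (lower_block (sym_unit i j) \in I).
  apply/existsP/idP => [[i' /existsP[j' /and3P[/eqP/val_inj-> /eqP/val_inj-> //]]]|ijI].
  by exists i; apply/existsP; exists j; rewrite !eqxx.
have DP m k : D m k ->
    exists i j : 'I_r, [/\ m = i, k = j & lower_block (sym_unit i j) \in I].
  by case/existsP => i /existsP[j /and3P[/eqP <- /eqP <- ijI]]; exists i, j.
have [|||l lr Dl] := @shape_exists r D.
- suff D_sym m k : D m k -> D k m by move=> m k; apply/idP/idP; apply: D_sym.
  by case/DP => i [j [-> -> ijI]]; rewrite DE sym_unitC.
- by move=> m k /DP[i [j [-> _ _]]].
- move=> m m' k le_m /DP[i [j [mi -> ijI]]]; rewrite mi in le_m.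
  have := DE (Ordinal (leq_ltn_trans le_m (ltn_ord i))) j => /= ->.
  exact: ideal_sym_unit_lower ijI.
exists l => //; apply/eqP; rewrite eqEsubv; apply/andP; split.
  apply/subvP => A AI; have [S symS defA] := abelian_ideal_lower abI AI.
  apply/mem_shape_ideal; exists S; split=> // i j Sij; rewrite -Dl DE.
  by apply: ideal_sym_unit symS _ Sij => //; rewrite -defA.
apply/span_subvP => _ /mapP[[i j] + ->]; rewrite mem_filter => /andP[/andP[/= _ lij] _].
by rewrite -DE Dl.
Qed.

End LowerBlocks.

(** * Counting abelian ideals *)

Local Open Scope classical_set_scope.
Local Open Scope card_scope.

Theorem card_abelian_ideals (F : numClosedFieldType) (r : nat)
    (b : {vspace 'M[F]_(r + r)}) (m : nat) :
    borel_subalgebra (sp F r) b ->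
  [set I | abelian_ideal b I /\ \dim I = m] #= `I_((f_C r)`_m)%R.
Proof.
move=> hb.
have [P uP Pb] := borel_conjugate hb.
have uP' : invmx P \in unitmx by rewrite unitmx_inv.
pose V l := (conjug (invmx P) @: shape_ideal F r l)%VS.
pose s := [seq l <- strict_partitions r | sumn l == m].
pose I_ i := V (nth [::] s i).
have mem_s i : (i < size s)%N ->
  nth [::] s i \in strict_partitions r /\ sumn (nth [::] s i) = m.
  by move=> /(mem_nth [::]); rewrite mem_filter => /andP[/eqP].
have V_inj : {in strict_partitions r &, injective V}.
  move=> l l' lr lr' /(congr1 (fun U => conjug P @: U)%VS).
  rewrite /V !conjug_imgVK // => eqV; apply: (shape_inj lr lr') => i j ir jr.
  by rewrite -!(shape_idealE F _ (Ordinal ir) (Ordinal jr)) eqV.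
have -> : (f_C r)`_m = size s by rewrite coef_f_C size_filter.
have -> : [set I | abelian_ideal b I /\ \dim I = m] = [set I_ i | i in `I_(size s)].
  apply/seteqP; split=> [I [abI dimI]|_ [i /mem_s[lr sum_m] <-]].
    have [l lr PI] : exists2 l,
      l \in strict_partitions r & (conjug P @: I)%VS = shape_ideal F r l.
      by apply: abelian_ideal_shape; rewrite -Pb; apply: conjug_abelian_ideal.
    have ls : l \in s by rewrite mem_filter lr -(dim_shape_ideal F lr) -PI
      dim_conjug // dimI eqxx.
    exists (index l s); first by rewrite /= index_mem.
    by rewrite /I_ nth_index // /V -PI conjug_imgK.
  split; last by rewrite /I_ /V dim_conjug // dim_shape_ideal.
  rewrite -(conjug_imgK b uP) Pb; apply: conjug_abelian_ideal => //.
  exact: shape_ideal_abelian.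
apply: inj_card_eq => i j; rewrite !inE => lt_i lt_j.
have [[ri _] [rj _]] := (mem_s i lt_i, mem_s j lt_j).
move=> /(V_inj _ _ ri rj)/eqP; rewrite nth_uniq ?filter_uniq ?uniq_strict_partitions //.
by move/eqP.
Qed.

Theorem proposition4p1 (R : realType) (r : nat) (hr : (2 <= r)%N)
    (b : {vspace 'M[complex R]_(r + r)})
    (hb : borel_subalgebra (sp (complex R) r) b) (m : nat) :
  [set I : {vspace 'M[complex R]_(r + r)} | abelian_ideal b I /\ (\dim I = m)%N]
    #= `I_((f_C r)`_m)%R.
Proof. exact: card_abelian_ideals hb. Qed.
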